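(* Consider an All-Against-One (AAO) linear quadratic differential game with $M$ players on $[t_0,t_f]$. Let $0<\delta\le t_f-t_0$, let $\mathcal I=[t_f-\delta,t_f]\subseteq[t_0,t_f]$, and let $\{S_i(t),\ i=1,\dots,M\}$ satisfy the coupled Riccati differential equations of the game over $\mathcal I$, with $S_i(t_f)=S_{if}$. Then for all $t\in\mathcal I$ we have $S_1(t)<0$ and $S_i(t)\ge 0$ for $i=2,3,\dots,M$.
   Context: For symmetric matrices, $>0,\ \ge 0,\ <0,\ \le 0$ mean positive definite, positive semidefinite, negative definite, negative semidefinite. AAO game: $M\ge 2$ players, time interval $[t_0,t_f]$, dynamics $\dot x=Ax+\sum_{j=1}^M B_ju_j$, $x(t_0)=x_0$, $x(t)\in\mathbb R^n$, and cost functions $J_i=\tfrac12 x^\intercal(t_f)S_{if}x(t_f)+\tfrac12\int_{t_0}^{t_f}[x^\intercal Q_ix+u_i^\intercal R_iu_i]\,dt$. The real matrices $A,B_i,Q_i,R_i$ (of proper dimensions) may depend on $t\in[t_0,t_f]$ and are bounded and piecewise continuous; $Q_i,R_i,S_{if}$ are symmetric; $R_i>0$ for $i=1,\dots,M$; $S_{1f}<0$ and $Q_1<0$; $S_{if}\ge0$ and $Q_i\ge0$ for $i=2,\dots,M$. Put $H_i=B_iR_i^{-1}B_i^\intercal$, assumed bounded. Coupled Riccati equations of the game: for $i=1,\dots,M$, $$\dot S_i+S_iA+A^\intercal S_i+Q_i+S_iH_iS_i-\sum_{j=1}^M\big(S_iH_jS_j+S_jH_jS_i\big)=0,\qquad S_i(t_f)=S_{if}.$$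 A solution set over an interval consists of continuous, piecewise continuously differentiable $n\times n$ symmetric matrix functions satisfying these equations (except possibly at finitely many points) together with the boundary conditions. *)

(* Defs.v *)
From HB Require Import structures.
From mathcomp Require Import all_boot all_order all_algebra.
From mathcomp Require Import all_classical all_reals all_analysis.

Set Implicit Arguments.
Unset Strict Implicit.
Unset Printing Implicit Defensive.

Import Order.TTheory GRing.Theory Num.Theory.
Import numFieldNormedType.Exports.

Local Open Scope classical_set_scope.
Local Open Scope ring_scope.

Section Definiteness.
Variables (R : realType) (n : nat).
Implicit Type X : 'M[R]_n.

(* Definiteness is a notion for symmetric matrices: each predicate includes
   symmetry. *)
Definition posdef X :=
  X^T = X /\ forall v : 'cV[R]_n, v != 0 -> 0 < (v^T *m X *m v) 0 0.

Definition possemidef X :=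
  X^T = X /\ forall v : 'cV[R]_n, 0 <= (v^T *m X *m v) 0 0.

Definition negdef X :=
  X^T = X /\ forall v : 'cV[R]_n, v != 0 -> (v^T *m X *m v) 0 0 < 0.

End Definiteness.

Section Piecewise.
Variables (R : realType) (V : normedModType R).

(* One-sided limits at the exceptional points are not required; boundedness is
   always assumed separately.  The end points of the interval count among the
   finitely many exceptional points, so the values of f outside [a, b] are
   irrelevant. *)
Definition piecewise_continuous (a b : R) (f : R -> V) :=
  exists E : seq R, forall t, t \in `]a, b[ -> t \notin E ->
    {for t, continuous f}.

Definition piecewise_C1 (a b : R) (f : R -> V) :=
  exists E : seq R, forall t, t \in `]a, b[ -> t \notin E ->
    derivable f t 1 /\ {for t, continuous (derive1 f)}.

End Piecewise.

(* The data of the M-player linear quadratic differential game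
     x' = A x + \sum_j B_j u_j,  x(t_init) = x0,
     J_i = 1/2 x(t_final)^T Sf_i x(t_final)
           + 1/2 \int_[t_init, t_final] (x^T Q_i x + u_i^T R_i u_i) dt,
   where player i uses a control with values in R^(ctrl_dim i). *)
Record lq_game (R : realType) (n M : nat) := LQGame {
  ctrl_dim : 'I_M -> nat;
  t_init : R;
  t_final : R;
  gx0 : 'cV[R]_n;
  gA : R -> 'M[R]_n;
  gB : forall i : 'I_M, R -> 'M[R]_(n, ctrl_dim i);
  gQ : 'I_M -> R -> 'M[R]_n;
  gR : forall i : 'I_M, R -> 'M[R]_(ctrl_dim i);
  gSf : 'I_M -> 'M[R]_n
}.

Definition gH (R : realType) (n M : nat) (G : lq_game R n M) (i : 'I_M) (t : R)
  : 'M[R]_n := gB G i t *m invmx (gR G i t) *m (gB G i t)^T.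

(* Players are numbered from 0: the lone player, "player 1" in the usual
   one-based numbering, is the index i of value 0. *)
Record all_against_one (R : realType) (n M : nat) (G : lq_game R n M) : Prop := {
  aao_players : (2 <= M)%N;
  aao_time : t_init G < t_final G;
  aao_A_pc : piecewise_continuous (t_init G) (t_final G) (gA G);
  aao_A_bounded : [bounded gA G t | t in `[t_init G, t_final G]];
  aao_B_pc : forall i, piecewise_continuous (t_init G) (t_final G) (gB G i);
  aao_B_bounded : forall i, [bounded gB G i t | t in `[t_init G, t_final G]];
  aao_Q_pc : forall i, piecewise_continuous (t_init G) (t_final G) (gQ G i);
  aao_Q_bounded : forall i, [bounded gQ G i t | t in `[t_init G, t_final G]];
  aao_R_pc : forall i, piecewise_continuous (t_init G) (t_final G) (gR G i);
  aao_R_bounded : forall i, [bounded gR G i t | t in `[t_init G, t_final G]];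
  aao_H_bounded : forall i, [bounded gH G i t | t in `[t_init G, t_final G]];
  aao_R_posdef : forall i t, t \in `[t_init G, t_final G] -> posdef (gR G i t);
  aao_Sf_lone : forall i : 'I_M, i = 0%N :> nat -> negdef (gSf G i);
  aao_Q_lone : forall i : 'I_M, i = 0%N :> nat ->
    forall t, t \in `[t_init G, t_final G] -> negdef (gQ G i t);
  aao_Sf_others : forall i : 'I_M, i <> 0%N :> nat -> possemidef (gSf G i);
  aao_Q_others : forall i : 'I_M, i <> 0%N :> nat ->
    forall t, t \in `[t_init G, t_final G] -> possemidef (gQ G i t)
}.

Definition riccati_at (R : realType) (n M : nat) (G : lq_game R n M)
    (S : 'I_M -> R -> 'M[R]_n) (i : 'I_M) (t : R) : Prop :=
  derive1 (S i) t + S i t *m gA G t + (gA G t)^T *m S i t + gQ G i t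
  + S i t *m gH G i t *m S i t
  - \sum_(j < M) (S i t *m gH G j t *m S j t + S j t *m gH G j t *m S i t) = 0.

(* {S_i} solves the coupled Riccati equations over [a, t_final]. *)
Record riccati_solution (R : realType) (n M : nat) (G : lq_game R n M) (a : R)
    (S : 'I_M -> R -> 'M[R]_n) : Prop := {
  ric_continuous : forall i, {within `[a, t_final G], continuous (S i)};
  ric_C1 : forall i, piecewise_C1 a (t_final G) (S i);
  ric_sym : forall i t, t \in `[a, t_final G] -> (S i t)^T = S i t;
  ric_eq : exists E : seq R, forall t, t \in `]a, t_final G[ -> t \notin E ->
    forall i, riccati_at G S i t;
  ric_final : forall i, S i (t_final G) = gSf G i
}.

(* Main.v *)
(** With the closed-loop matrix [F = A - \sum_j H_j S_j], bounded on the
    interval, the coupled equations decouple into Lyapunov equations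
    [S_i' + S_i F + F^T S_i + Q_i + S_i H_i S_i = 0].  For the other players the
    forcing term [Q_i + S_i H_i S_i] is positive semidefinite; for the lone
    player the quadratic term is absorbed into [F + H_1 S_1 / 2], which leaves
    the forcing term [- Q_1 > 0] in the equation of [- S_1].  Positivity of a
    solution propagates backwards in time: at the last time [t] at which it
    fails there is a null vector [v] of [S t], and a coercive forcing term
    makes [v^T S v] decrease just after [t], although it is [0] at [t] and
    positive afterwards.  A forcing term that is only semidefinite is made
    coercive by adding to [S] a scalar matrix [e exp(k t) I]. *)
Require Import Defs.
From HB Require Import structures.
From mathcomp Require Import all_boot all_order all_algebra.
From mathcomp Require Import all_classical all_reals all_analysis.
From mathcomp Require Import ring lra.
Import Order.TTheory GRing.Theory Num.Theory.
Import numFieldNormedType.Exports.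
Local Open Scope classical_set_scope.
Local Open Scope ring_scope.

(** * Quadratic forms as linear functionals of the matrix *)

Definition qform {R : realType} {n : nat} (v : 'cV[R]_n) (X : 'M[R]_n) : R :=
  (v^T *m X *m v) 0 0.

Lemma qform_is_linear {R : realType} {n : nat} (v : 'cV[R]_n) :
  linear (qform v : 'M[R]_n -> R^o).
Proof.
by move=> a X Y; rewrite /qform mulmxDr mulmxDl -scalemxAr -scalemxAl !mxE.
Qed.

HB.instance Definition _ (R : realType) (n : nat) (v : 'cV[R]_n) :=
  GRing.isLinear.Build R 'M[R]_n R^o _ (qform v) (qform_is_linear v).

Section QuadraticForm.
Context {R : realType} {n : nat} (v : 'cV[R]_n).
Implicit Types X Y : 'M[R]_n.

Lemma qformD X Y : qform v (X + Y) = qform v X + qform v Y.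
Proof. exact: (linearD (qform v)). Qed.

Lemma qformN X : qform v (- X) = - qform v X.
Proof. exact: (linearN (qform v)). Qed.

Lemma qformZ a X : qform v (a *: X) = a * qform v X.
Proof. exact: (linearZ_LR (qform v)). Qed.

Lemma qform_tr X : qform v X^T = qform v X.
Proof.
have -> : qform v X^T = (v^T *m X *m v)^T 0 0.
  by rewrite !trmx_mul trmxK mulmxA.
by rewrite mxE.
Qed.

End QuadraticForm.

(** * Entrywise sup norm and its bounds on quadratic forms *)

Section MatrixNorm.
Context {R : realType}.

Lemma le_mx_norm {m n : nat} (X : 'M[R]_(m, n)) i j : `|X i j| <= `|X|.
Proof.
rewrite [leRHS]/Num.Def.normr/= mx_normrE.
exact: (le_bigmax _ (fun ij => `|X ij.1 ij.2|) (i, j)).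
Qed.

Lemma mx_norm_le {m n : nat} (X : 'M[R]_(m, n)) (c : R) :
  0 <= c -> (forall i j, `|X i j| <= c) -> `|X| <= c.
Proof.
move=> c0 Xc; rewrite [leLHS]/Num.Def.normr/= mx_normrE.
by apply: bigmax_le => // -[i j] _; exact: Xc.
Qed.

Lemma mx_norm_tr {m n : nat} (X : 'M[R]_(m, n)) : `|X^T| = `|X|.
Proof.
have le_tr p q (Y : 'M[R]_(p, q)) : `|Y^T| <= `|Y|.
  by apply: mx_norm_le => // i j; rewrite mxE le_mx_norm.
by apply/eqP; rewrite eq_le le_tr -{1}[X]trmxK le_tr.
Qed.

(** The norm is the largest absolute value of an entry, and an entry of the product is a sum of [n]
    terms; hence the factor [n%:R]. *)
Lemma mx_norm_mul {m n p : nat} (X : 'M[R]_(m, n)) (Y : 'M[R]_(n, p)) :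
  `|X *m Y| <= n%:R * `|X| * `|Y|.
Proof.
apply: mx_norm_le => [|i j]; first by rewrite !mulr_ge0.
rewrite mxE (le_trans (ler_norm_sum _ _ _))//.
rewrite (le_trans (ler_sum _ (G := fun=> `|X| * `|Y|) _))//.
  by move=> k _; rewrite normrM ler_pM// le_mx_norm.
by rewrite sumr_const card_ord -mulrA mulr_natl.
Qed.

Lemma norm_qform_le {n : nat} (v : 'cV[R]_n) (X : 'M[R]_n) :
  `|qform v X| <= n%:R ^+ 2 * `|X| * `|v| ^+ 2.
Proof.
apply: (le_trans (le_mx_norm _ _ _)); apply: (le_trans (mx_norm_mul _ _)).
have := mx_norm_mul v^T X; rewrite mx_norm_tr => /(ler_wpM2l (ler0n R n)).
move=> /(ler_wpM2r (normr_ge0 v)); nra.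
Qed.

Lemma sqr_mx_norm_le {n : nat} (v : 'cV[R]_n) (c : R) :
  (forall i, v i 0 ^+ 2 <= c) -> 0 <= c -> `|v| ^+ 2 <= c.
Proof.
move=> vc c0; rewrite -[leRHS](sqr_sqrtr c0) ler_pXn2r ?nnegrE ?sqrtr_ge0//.
apply: mx_norm_le => [|i j]; first exact: sqrtr_ge0.
by rewrite ord1 -sqrtr_sqr ler_wsqrtr.
Qed.

(** The right side is the squared Euclidean norm, of which each squared entry is a summand. *)
Lemma sqr_mx_norm_le_qform1 {n : nat} (v : 'cV[R]_n) :
  `|v| ^+ 2 <= qform v 1%:M.
Proof.
have q1 : qform v 1%:M = \sum_i v i 0 ^+ 2.
  by rewrite /qform mulmx1 mxE; apply: eq_bigr => i _; rewrite mxE expr2.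
apply: sqr_mx_norm_le => [i|]; rewrite q1.
  by rewrite (bigD1 i)//= lerDl sumr_ge0// => j _; exact: sqr_ge0.
by apply: sumr_ge0 => i _; exact: sqr_ge0.
Qed.

Lemma qform1_ge0 {n : nat} (v : 'cV[R]_n) : 0 <= qform v 1%:M.
Proof. by rewrite (le_trans _ (sqr_mx_norm_le_qform1 v)) ?sqr_ge0. Qed.

Lemma qform1_gt0 {n : nat} (v : 'cV[R]_n) : v != 0 -> 0 < qform v 1%:M.
Proof.
move=> v0; rewrite (lt_le_trans _ (sqr_mx_norm_le_qform1 v))//.
by rewrite exprn_gt0// normr_gt0.
Qed.

Lemma qform_continuous {n : nat} (v : 'cV[R]_n) :
  continuous (qform v : 'M[R]_n -> R^o).
Proof.
apply/(linear_bounded_continuous (qform v : {linear _ -> R^o}))/linear_boundedP.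
near=> r => X; apply: (le_trans (norm_qform_le v X)).
rewrite mulrAC ler_wpM2r//; near: r; apply: nbhs_pinfty_ge; exact: num_real.
Unshelve. all: by end_near. Qed.

End MatrixNorm.

(** * Algebra of definite and semidefinite matrices *)

Section Definite.
Context {R : realType} {n : nat}.
Implicit Types X Y : 'M[R]_n.

Lemma possemidefW X : posdef X -> possemidef X.
Proof.
move=> [Xs Xp]; split=> // v; have [->|/Xp/ltW//] := eqVneq v 0.
by rewrite mulmx0 mxE.
Qed.

Lemma posdefN X : negdef X <-> posdef (- X).
Proof.
have E v : (v^T *m - X *m v) 0 0 = - (v^T *m X *m v) 0 0.
  by rewrite mulmxN mulNmx mxE.
split=> -[Xs Xn]; split; rewrite ?linearN/= ?Xs//.
- by move=> v /Xn; rewrite E oppr_gt0.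
- by apply: oppr_inj; rewrite -Xs linearN.
- by move=> v /Xn; rewrite E oppr_gt0.
Qed.

Lemma possemidef_CauchySchwarz X (u v : 'cV[R]_n) : possemidef X ->
  (u^T *m X *m v) 0 0 ^+ 2 <= qform u X * qform v X.
Proof.
move=> [Xs Xp]; set b := (_ *m v) 0 0.
have vu : (v^T *m X *m u) 0 0 = b.
  by rewrite -[in LHS](trmxK (_ *m u)) mxE !trmx_mul trmxK Xs mulmxA.
have q x y : 0 <= x ^+ 2 * qform u X + 2 * x * y * b + y ^+ 2 * qform v X.
  rewrite (le_trans (Xp (x *: u + y *: v)))//.
  have -> : (x *: u + y *: v)^T = x *: u^T + y *: v^T.
    by rewrite linearD !linearZ.
  rewrite !(mulmxDl, mulmxDr) -!(scalemxAl, scalemxAr).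
  have De (Y Z : 'M[R]_1) : (Y + Z) 0 0 = Y 0 0 + Z 0 0 by rewrite mxE.
  have Ze c (Z : 'M[R]_1) : (c *: Z) 0 0 = c * Z 0 0 by rewrite mxE.
  by rewrite !(De, Ze) vu -/b -!/(qform _ _); lra.
have := Xp u; have := Xp v; rewrite -!/(qform _ _).
move: (qform u X) (qform v X) q => p r q r0 p0.
(* The form may be degenerate, hence three cases. If [p != 0], the point [(b, - p)] gives
   [0 <= p * (p * r - b ^+ 2)]; if [r != 0], the point [(r, - b)] gives the same with factor [r]; if
   both vanish, [(1, - b)] gives [- 2 * b ^+ 2 >= 0]. *)
have [pE|pn] := eqVneq p 0; last first.
  have pp : 0 < p by rewrite lt0r pn p0.
  by rewrite -subr_ge0 -(pmulr_rge0 _ pp); have := q b (- p); lra.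
have [rE|rn] := eqVneq r 0; last first.
  have rp : 0 < r by rewrite lt0r rn r0.
  by rewrite -subr_ge0 -(pmulr_rge0 _ rp); have := q r (- b); lra.
by have := q 1 (- b); rewrite pE rE; lra.
Qed.

(** Cauchy-Schwarz against the basis vector [delta_mx i 0] bounds the square of the [i]-th entry of
    [X *m v] by [0]. *)
Lemma qform_eq0_mulmx X (v : 'cV[R]_n) :
  possemidef X -> qform v X = 0 -> X *m v = 0.
Proof.
move=> Xp v0; apply/matrixP => i j; rewrite ord1 [RHS]mxE.
have := possemidef_CauchySchwarz X (delta_mx i 0) v Xp.
rewrite v0 mulr0 -mulmxA trmx_delta -rowE mxE => h.
by apply/eqP; rewrite -sqrf_eq0 eq_le h sqr_ge0.
Qed.

Lemma posdef_unitmx X : posdef X -> X \in unitmx.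
Proof.
move=> [Xs Xp]; rewrite -row_free_unit -kermx_eq0; apply/eqP/row_matrixP => i.
rewrite row0; apply/eqP; apply: contraT => ki.
have /Xp : (row i (kermx X))^T != 0 by rewrite -(inj_eq trmx_inj) trmxK trmx0.
by rewrite trmxK -row_mul mulmx_ker row0 mul0mx mxE ltxx.
Qed.

(** The form of [invmx X] at [v] is the form of [X] at [invmx X *m v]. *)
Lemma possemidef_inv X : posdef X -> possemidef (invmx X).
Proof.
move=> Xp; have Xu := posdef_unitmx _ Xp; have [Xs _] := Xp.
have Xi : (invmx X)^T = invmx X by rewrite trmx_inv Xs.
split=> // v; have [_ /(_ (invmx X *m v))] := possemidefW _ Xp.
by rewrite trmx_mul Xi !mulmxA mulmxKV.
Qed.

(** Cauchy-Schwarz for [X] with the vector [X^-1 e_i] bounds [v i 0 ^+ 2] by the [i]-th diagonal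
    entry of [X^-1] times [qform v X]. The [+ 1] keeps the denominator positive. *)
Lemma posdef_coercive X : posdef X ->
  exists2 c, 0 < c & forall v, c * `|v| ^+ 2 <= qform v X.
Proof.
move=> Xp; have Xu := posdef_unitmx _ Xp; have [Xs _] := Xp.
have Xi : (invmx X)^T = invmx X by rewrite trmx_inv Xs.
exists (`|invmx X| + 1)^-1; first by rewrite invr_gt0 ltr_wpDl.
move=> v; rewrite mulrC ler_pdivrMr ?ltr_wpDl//.
have q0 : 0 <= qform v X by have [_ /(_ v)] := possemidefW _ Xp.
apply: sqr_mx_norm_le => [i|]; last by rewrite mulr_ge0// addr_ge0.
(* [v i 0 = (X^-1 e_i)^T X v]. *)
have := possemidef_CauchySchwarz X (invmx X *m delta_mx i 0) v (possemidefW _ Xp).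
rewrite trmx_mul Xi mulmxKV//.
have -> : qform (invmx X *m delta_mx i 0) X = invmx X i i.
  by rewrite /qform trmx_mul Xi mulmxKV// trmx_delta mulmxA -rowE -colE !mxE.
rewrite trmx_delta -rowE mxE => /le_trans -> //; rewrite mulrC ler_wpM2l//.
by rewrite (le_trans (ler_norm _))// (le_trans (le_mx_norm _ _ _))// lerDl.
Qed.

End Definite.

(** * Differentiation, backward induction and the last failure time *)

Section Analysis.
Context {R : realType}.

Lemma is_derive_qform {n : nat} (v : 'cV[R]_n) (T : R -> 'M[R]_n) (t : R) D :
  is_derive t (1 : R) T D ->
  is_derive t (1 : R) (fun s => qform v (T s)) (qform v D).
Proof.
move=> [Td TD].
have cT : h^-1 *: (T (h *: 1 + t) - T t) @[h --> 0^'] --> D by rewrite -TD.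
have cq : h^-1 *: (qform v (T (h *: 1 + t)) - qform v (T t) : R^o)
    @[h --> 0^'] --> qform v D.
  have := cvg_comp _ _ cT (qform_continuous v D); apply: cvg_trans.
  by apply: near_eq_cvg; near=> h; rewrite /= linearZ linearB.
by split; [apply/cvg_ex; exists (qform v D)|apply: cvg_lim].
Unshelve. all: by end_near. Qed.

Lemma near_right_notin (E : seq R) (t : R) : \forall s \near t^'+, s \notin E.
Proof.
elim: E => [|x E IH]; first exact: nearW.
suff xP : \forall s \near t^'+, s != x.
  by near=> s; rewrite in_cons negb_or; apply/andP; split; near: s.
have [xt|tx] := leP x t.
  by near=> s; rewrite gt_eqF// (le_lt_trans xt).
by near=> s; rewrite lt_eqF//; near: s; exact: nbhs_right_lt.
Unshelve. all: by end_near. Qed.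

(** Real induction towards the left: if [P] fails somewhere, it holds at the supremum of the failure
    set by [Pb] or the step hypothesis, and openness then excludes failures close to that
    supremum. *)
Lemma backward_induction (P : R -> Prop) (a b : R) :
  P b ->
  (forall t, a <= t <= b -> P t -> \forall s \near t, a <= s <= b -> P s) ->
  (forall t, a <= t < b -> (forall s, t < s <= b -> P s) -> P t) ->
  forall t, a <= t <= b -> P t.
Proof.
move=> Pb open step t abt; apply: contrapT => nPt.
pose N := [set s | a <= s <= b /\ ~ P s].
have supN : has_sup N.
  by split; [exists t|exists b => s [/andP[]]].
have abN : a <= sup N <= b.
  apply/andP; split; last by apply: ge_sup; [exists t|move=> s [/andP[]]].
  apply: (le_trans (proj1 (andP abt))); exact: (sup_upper_bound supN).
have PN s : sup N < s <= b -> P s.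
  move=> /andP[Ns sb]; apply: contrapT => nPs.
  have : s <= sup N.
    apply: (sup_upper_bound supN); split=> //.
    by rewrite sb andbT ltW// (le_lt_trans _ Ns)//; case/andP: abN.
  by rewrite leNgt Ns.
have PsN : P (sup N).
  have [->//|Nb] := eqVneq (sup N) b; apply: step => //.
  by case/andP: abN => -> /=; rewrite lt_neqAle Nb.
have /nbhs_ballP[e /= e0 eP] := open _ abN PsN.
have [s Ns es] := sup_adherent e0 supN.
case: (Ns) => abs; apply; apply: eP => //=.
have sN : s <= sup N by exact: (sup_upper_bound supN).
by rewrite /ball /= ger0_norm ?subr_ge0// ltrBlDr -ltrBlDl.
Qed.

(* At the exceptional points and at [t] itself [T] need not be differentiable,
   so the mean value theorem is applied on an interval just after [t] that
   avoids them. *)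
Lemma lyapunov_posdef_step {n : nat} (T F W : R -> 'M[R]_n) (E : seq R)
    (a b f c : R) :
  {within `[a, b], continuous T} ->
  (forall t, a <= t <= b -> (T t)^T = T t) ->
  (forall t, a <= t <= b -> `|F t| <= f) ->
  (forall t, a < t < b -> t \notin E ->
    is_derive t (1 : R) T (- (T t *m F t + (F t)^T *m T t + W t))) ->
  0 < c ->
  (forall t, a <= t <= b -> forall v, c * `|v| ^+ 2 <= qform v (W t)) ->
  forall t, a <= t < b -> (forall s, t < s <= b -> posdef (T s)) ->
  posdef (T t).
Proof.
move=> cT symT Ff dT c0 Wc t /andP[at_ tb] Tpos.
have abt : a <= t <= b by rewrite at_ ltW.
have rT : T s @[s --> t^'+] --> T t.
  have /subspace_continuousP/(_ t) := cT.
  rewrite /= in_itv/= abt => /(_ isT) cTt; apply/cvgrPdist_lt => e e0.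
  move/cvgrPdist_lt : cTt => /(_ e e0); rewrite near_withinE => cTt.
  rewrite near_withinE; near=> s; move=> ts.
  apply: (near cTt s); first by [].
  by rewrite /= in_itv/= (le_trans at_ (ltW ts)) ltW//; near: s; exact: lt_nbhsl.
(* A limit from the right of positive definite matrices is semidefinite, so failure of definiteness
   at [t] can only come from a null vector. *)
have Tnneg : possemidef (T t).
  split=> [|v]; first exact: symT.
  have rq : qform v (T s) @[s --> t^'+] --> qform v (T t).
    exact: cvg_comp rT (qform_continuous v _).
  have -> : (v^T *m T t *m v) 0 0 = lim (qform v (T s) @[s --> t^'+]).
    exact/esym/cvg_lim.
  apply: limr_ge; first by apply/cvg_ex; exists (qform v (T t)).
  near=> s; apply: (proj2 (possemidefW _ (Tpos s _))).
  apply/andP; split; near: s; [exact: nbhs_right_gt|].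
  exact: nbhs_right_ltW.
split=> [|v v0]; first exact: symT.
rewrite lt_neqAle (proj2 Tnneg v) andbT eq_sym; apply/eqP => q0.
have Tv0 : T t *m v = 0 by exact: qform_eq0_mulmx.
have f0 : 0 <= f by rewrite (le_trans _ (Ff _ abt)).
have nv0 : 0 < `|v| by rewrite normr_gt0.
(* This size gives [2 * n^2 * f * e <= c * |v|]: as long as [|T s *m v| < e], the two terms with [F]
   cannot outweigh the forcing term. The [+ 1] covers [f = 0]. *)
pose e := c * `|v| / (2 * (n%:R ^+ 2 * f) + 1) / 2.
have e0 : 0 < e.
  by rewrite !divr_gt0 ?mulr_gt0// ltr_wpDl// !mulr_ge0.
have rTv : \forall s \near t^'+, `|T s *m v| < e.
  have /cvgrPdist_lt/(_ (e / (n%:R * `|v| + 1))) := rT.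
  rewrite divr_gt0 ?ltr_wpDl ?mulr_ge0// => /(_ isT); apply: filterS => s.
  rewrite distrC ltr_pdivlMr ?ltr_wpDl ?mulr_ge0//; apply: le_lt_trans.
  have -> : T s *m v = (T s - T t) *m v by rewrite mulmxBl Tv0 subr0.
  rewrite (le_trans (mx_norm_mul _ _))//.
  by have := normr_ge0 (T s - T t); nra.
have : \forall s \near t^'+, `|T s *m v| < e /\ s \notin E.
  by apply: filterI => //; exact: near_right_notin.
move=> /nbhs_ballP[d /= d0 dP].
pose r := Num.min b (t + d / 2).
have tr : t < r by rewrite lt_min tb ltrDl divr_gt0.
have rb : r <= b by rewrite ge_min lexx.
have rd : r < t + d by rewrite gt_min ltrD2l gtr_pMr ?invf_lt1 ?ltr1n ?orbT.
have {}dP s : s \in `]t, r[ -> `|T s *m v| < e /\ s \notin E.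
  rewrite in_itv/= => /andP[ts sr]; apply: dP => //.
  by rewrite /ball/= distrC ger0_norm ?subr_ge0 ?ltW// ltrBlDl (lt_trans sr).
have trab s : s \in `]t, r[ -> a < s < b.
  rewrite in_itv/= => /andP[ts sr].
  by rewrite (le_lt_trans at_ ts) (lt_le_trans sr rb).
have dq s : s \in `]t, r[ -> is_derive s (1 : R) (fun s => qform v (T s))
    (qform v (- (T s *m F s + (F s)^T *m T s + W s))).
  by move=> sI; apply: is_derive_qform; apply: dT; [exact: trab|case: (dP s sI)].
have cq : {within `[t, r], continuous (fun s => qform v (T s) : R^o)}.
  have : {within `[t, r], continuous T}.
    apply: continuous_subspaceW cT => s /=; rewrite !in_itv/= => /andP[ts sr].
    by rewrite (le_trans at_ ts) (le_trans sr rb).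
  move=> cT' s; exact: continuous_comp (cT' s) (qform_continuous v _).
(* Since the form vanishes at [t] and is positive at [r], its derivative at [s] must be positive;
   the estimates below show that it is at most [0]. *)
have [s sI] := MVT tr dq cq.
have [Tsv _] := dP s sI.
have absT : a <= s <= b by have /andP[/ltW-> /ltW->] := trab s sI.
have qr : 0 < qform v (T r) by apply: (proj2 (Tpos r _)) => //; rewrite tr.
rewrite -[X in _ - X]/((v^T *m T t *m v) 0 0) q0 subr0 => qE.
have : 0 < qform v (- (T s *m F s + (F s)^T *m T s + W s)).
  by move: qr; rewrite qE pmulr_lgt0 ?subr_gt0.
apply/negP; rewrite -leNgt.
have qTF : qform v (T s *m F s) = ((T s *m v)^T *m F s *m v) 0 0.
  by rewrite /qform trmx_mul symT// !mulmxA.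
have qE' : qform v (- (T s *m F s + (F s)^T *m T s + W s)) =
    - (qform v (T s *m F s) * 2 + qform v (W s)).
  have -> : (F s)^T *m T s = (T s *m F s)^T by rewrite trmx_mul symT.
  by rewrite qformN !qformD qform_tr mulr_natr mulr2n.
rewrite qE' oppr_le0 qTF.
have h1 : `|((T s *m v)^T *m F s *m v) 0 0| <= n%:R ^+ 2 * f * e * `|v|.
  apply: (le_trans (le_mx_norm _ _ _)); apply: (le_trans (mx_norm_mul _ _)).
  rewrite ler_wpM2r// expr2 -!mulrA ler_wpM2l//.
  apply: (le_trans (mx_norm_mul _ _)); rewrite mx_norm_tr -mulrA ler_wpM2l//.
  by rewrite mulrC ler_pM// ?Ff// ltW.
have h2 : n%:R ^+ 2 * f * e * 2 <= c * `|v|.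
  rewrite /e; set k := n%:R ^+ 2 * f; have k0 : 0 <= k by rewrite mulr_ge0.
  have k1 : 0 < 2 * k + 1 by lra.
  have -> : k * (c * `|v| / (2 * k + 1) / 2) * 2 =
      c * `|v| * (k / (2 * k + 1)) by field; rewrite gt_eqF.
  rewrite ler_piMr ?mulr_ge0 ?(ltW c0)//; rewrite ler_pdivrMr; lra.
have := Wc _ absT v; move: h1; rewrite ler_norml => /andP[h1 _].
by have := ler_wpM2r (ltW nv0) h2; nra.
Unshelve. all: by end_near. Qed.

End Analysis.

(** * Backward propagation of definiteness in Lyapunov equations *)

Section Lyapunov.
Context {R : realType} {n : nat}.

Lemma lyapunov_posdef (T F W : R -> 'M[R]_n) (E : seq R) (a b f c : R) :
  {within `[a, b], continuous T} ->
  (forall t, a <= t <= b -> (T t)^T = T t) ->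
  (forall t, a <= t <= b -> `|F t| <= f) ->
  (forall t, a < t < b -> t \notin E ->
    is_derive t (1 : R) T (- (T t *m F t + (F t)^T *m T t + W t))) ->
  0 < c ->
  (forall t, a <= t <= b -> forall v, c * `|v| ^+ 2 <= qform v (W t)) ->
  posdef (T b) -> forall t, a <= t <= b -> posdef (T t).
Proof.
move=> cT symT Ff dT c0 Wc Tb; apply: backward_induction => //; last first.
  exact: lyapunov_posdef_step cT symT Ff dT c0 Wc.
(* Definiteness is an open condition: once [|T t - T s| < d / (n^2 + 1)], the form at [v] changes by
   less than its margin [d * |v|^2]. *)
move=> t abt Tt; have [d d0 dT'] := posdef_coercive _ Tt.
have /subspace_continuousP/(_ t) := cT.
rewrite /= in_itv/= abt => /(_ isT)/cvgrPdist_lt/(_ (d / (n%:R ^+ 2 + 1))).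
have n0 : (0 : R) < n%:R ^+ 2 + 1 by rewrite ltr_wpDl.
rewrite divr_gt0// => /(_ isT); rewrite near_withinE; apply: filterS => s Ts abs.
split=> [|v v0]; first exact: symT.
have {Ts} := Ts; rewrite /= in_itv/= abs => /(_ isT).
rewrite ltr_pdivlMr// => Ts.
have v2 : 0 < `|v| ^+ 2 by rewrite exprn_gt0// normr_gt0.
have := norm_qform_le v (T t - T s); rewrite ler_norml => /andP[_].
rewrite qformD qformN -[X in 0 < X]/(qform v (T s)).
have := dT' v; have := normr_ge0 (T t - T s).
move: `|_ - _| Ts => r rd r0 h1 h2.
have : n%:R ^+ 2 * r < d by lra.
by rewrite -(ltr_pM2r v2); lra.
Qed.

Lemma is_derive_scale (s : R -> R) (C : 'M[R]_n) (t ds : R) :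
  is_derive t (1 : R) s ds ->
  is_derive t (1 : R) (fun x => s x *: C) (ds *: C).
Proof.
move=> [sd sD].
have cs : h^-1 *: (s (h *: 1 + t) - s t) @[h --> 0^'] --> ds by rewrite -sD.
have cC : h^-1 *: (s (h *: 1 + t) *: C - s t *: C) @[h --> 0^'] --> ds *: C.
  have : (h^-1 *: (s (h *: 1 + t) - s t)) *: C @[h --> 0^'] --> ds *: C.
    by apply: cvgZ; [exact: cs|exact: cvg_cst].
  apply: cvg_trans; apply: near_eq_cvg.
  by near=> h; rewrite -scalerBl scalerA.
by split; [apply/cvg_ex; exists (ds *: C)|apply: cvg_lim].
Unshelve. all: by end_near. Qed.

Lemma is_derive_exp_scale (e k t : R) :
  is_derive t (1 : R) (fun x => e * expR (k * x)) (k * (e * expR (k * t))).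
Proof.
have kx : is_derive t (1 : R) (fun x : R => k * x) k.
  by have := is_deriveZ k (is_derive_id t (1 : R)); rewrite [k *: 1]mulr1.
have -> : k * (e * expR (k * t)) = e *: (expR (k * t) * k).
  by rewrite -[RHS]/(e * (expR (k * t) * k)); ring.
by have := is_deriveZ e (is_derive1_comp (is_derive_expR (k * t)) kx).
Qed.

(** The shift contributes [k * |sigma|] times the identity to the forcing term, at the price of
    [sigma * (F + F^T)], whose form is at most [2 * n^2 * f * |sigma| * |v|^2]. The rate
    [k = 2 * n^2 * f + 1] leaves [|sigma| * |v|^2], so the new forcing term is coercive for [sigma]
    of either sign. *)
Lemma lyapunov_posdef_shift (S F P : R -> 'M[R]_n) (sigma : R -> R)
    (E : seq R) (a b f c : R) :
  {within `[a, b], continuous S} ->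
  (forall t, a <= t <= b -> (S t)^T = S t) ->
  (forall t, a <= t <= b -> `|F t| <= f) ->
  (forall t, a < t < b -> t \notin E ->
    is_derive t (1 : R) S (- (S t *m F t + (F t)^T *m S t + P t))) ->
  (forall t, a <= t <= b -> forall v, 0 <= qform v (P t)) ->
  (forall t, is_derive t (1 : R) sigma
     (- (2 * (n%:R ^+ 2 * f) + 1) * `|sigma t|)) ->
  0 < c -> (forall t, a <= t <= b -> c <= `|sigma t|) ->
  posdef (S b + sigma b *: 1%:M) ->
  forall t, a <= t <= b -> posdef (S t + sigma t *: 1%:M).
Proof.
move=> cS symS Ff dS P0 dsigma c0 csigma Tb.
(* [W] is the forcing term of the Lyapunov equation satisfied by [T]. *)
set k := 2 * _ + 1 in dsigma.
pose T t := S t + sigma t *: 1%:M.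
pose W t := P t + (k * `|sigma t|) *: 1%:M - sigma t *: (F t + (F t)^T).
have := @lyapunov_posdef T F W E a b f c; apply=> [||//||//||//].
- have csig : {within `[a, b], continuous sigma}.
    apply: continuous_subspaceT => t; apply: differentiable_continuous.
    by apply/derivable1_diffP; case: (dsigma t).
  by move=> s; apply: cvgD; [exact: cS|apply: cvgZ; [exact: csig|exact: cvg_cst]].
- by move=> t /symS St; rewrite linearD linearZ/= St tr_scalar_mx.
- move=> t abt tE; have dSt := dS t abt tE.
  have ds := is_derive_scale _ 1%:M _ _ (dsigma t).
  have := is_deriveD dSt ds; congr is_derive.
  rewrite mulmxDl mulmxDr -scalemxAl -scalemxAr mul1mx mulmx1 mulNr scaleNr.
  rewrite /W; apply/matrixP => i j; rewrite !mxE; ring.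
- move=> t abt v; rewrite !(qformD, qformN, qformZ) qform_tr.
  have f0 : 0 <= f by rewrite (le_trans _ (Ff t abt)).
  have h1 := csigma t abt; have h2 := P0 t abt v.
  have h3 := sqr_mx_norm_le_qform1 v.
  have h4 : `|qform v (F t)| <= n%:R ^+ 2 * f * `|v| ^+ 2.
    rewrite (le_trans (norm_qform_le _ _))// ler_wpM2r ?sqr_ge0//.
    by rewrite ler_wpM2l ?sqr_ge0// Ff.
  have h5 : sigma t * qform v (F t) <= `|sigma t| * (n%:R ^+ 2 * f * `|v| ^+ 2).
    by rewrite (le_trans (ler_norm _))// normrM ler_wpM2l.
  have h6 := ler_wpM2r (sqr_ge0 `|v|) h1.
  have k0 : 0 <= k * `|sigma t|.
    by rewrite mulr_ge0// /k addr_ge0// mulr_ge0// mulr_ge0// sqr_ge0.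
  have h7 := ler_wpM2l k0 h3.
  rewrite /k in h7 *; lra.
Qed.

Section Weighted.
Context (S F P : R -> 'M[R]_n) (E : seq R) (a b f : R).
Hypothesis cS : {within `[a, b], continuous S}.
Hypothesis symS : forall t, a <= t <= b -> (S t)^T = S t.
Hypothesis Ff : forall t, a <= t <= b -> `|F t| <= f.
Hypothesis dS : forall t, a < t < b -> t \notin E ->
  is_derive t (1 : R) S (- (S t *m F t + (F t)^T *m S t + P t)).
Hypothesis P0 : forall t, a <= t <= b -> forall v, 0 <= qform v (P t).

Let k : R := 2 * (n%:R ^+ 2 * f) + 1.

(** Here [s] is minus the sign of [e], so that [sigma' = s * k * sigma = - k * |sigma|] for positive
    and negative shifts alike. *)
Lemma lyapunov_exp_shift (e s : R) : e != 0 -> s * e = - `|e| ->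
  `|s| = 1 ->
  let sigma t := e * expR (s * k * t) in
  posdef (S b + sigma b *: 1%:M) ->
  forall t, a <= t <= b -> posdef (S t + sigma t *: 1%:M).
Proof.
(* A lower bound of [|sigma|] on the interval, because [|t| <= |a| + |b|] there. *)
move=> e0 se s1 sigma; pose c := `|e| * expR (- (`|k| * (`|a| + `|b|))).
apply: (@lyapunov_posdef_shift S F P sigma E a b f c) => //.
- move=> t; have -> : - (2 * (n%:R ^+ 2 * f) + 1) * `|sigma t| =
      s * k * (e * expR (s * k * t)).
    rewrite normrM (ger0_norm (expR_ge0 _)) -/k mulrA [s * k * e]mulrAC se.
    by rewrite !mulNr mulrA [k * _]mulrC.
  exact: is_derive_exp_scale.
- by rewrite mulr_gt0 ?normr_gt0 ?expR_gt0.
- move=> t /andP[at_ tb]; rewrite normrM (ger0_norm (expR_ge0 _)).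
  rewrite ler_wpM2l// ler_expR lerNl; apply: (le_trans (ler_norm _)).
  rewrite normrN !normrM s1 mul1r ler_wpM2l// ler_norml.
  have := ler_norm b; have := ler_norm (- a); rewrite normrN.
  have := normr_ge0 a; have := normr_ge0 b; lra.
Qed.

(** A positive shift makes the terminal value definite; it is then made arbitrarily small at the
    given [t] and [v]. *)
Lemma lyapunov_possemidef : possemidef (S b) ->
  forall t, a <= t <= b -> possemidef (S t).
Proof.
move=> [Sbs Sb] t abt; split=> [|v]; first exact: symS.
rewrite -/(qform v _); apply/ler_addgt0Pr => d d0.
pose y := expR (- 1 * k * t) * qform v 1%:M.
have y0 : 0 <= y by apply: mulr_ge0; [exact: expR_ge0|exact: qform1_ge0].
(* With this [e] the shift changes the form at [v] by [e * y <= d]. *)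
pose e := d / (y + 1).
have e0 : 0 < e by rewrite divr_gt0// ltr_wpDl.
have : posdef (S t + (e * expR (- 1 * k * t)) *: 1%:M).
  apply: (@lyapunov_exp_shift e (- 1)) => //.
  - by rewrite gt_eqF.
  - by rewrite gtr0_norm// mulN1r.
  - by rewrite normrN1.
  split=> [|w w0]; first by rewrite linearD linearZ/= Sbs tr_scalar_mx.
  rewrite -/(qform w _) qformD qformZ ltr_wpDl//; first exact: Sb.
  by apply: mulr_gt0; [rewrite mulr_gt0 ?expR_gt0|exact: qform1_gt0].
move=> /possemidefW[_ /(_ v)]; rewrite -/(qform v _) qformD qformZ.
rewrite -[e * _ * _]mulrA -/y => /le_trans -> //; rewrite lerD2l /e mulrAC ler_pdivrMr ?ltr_wpDl//.
by apply: ler_wpM2l; [exact: ltW|rewrite lerDl].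
Qed.

(** The shift is now negative: coercivity of [S b] leaves room to subtract a small multiple of the
    identity, and adding it back at time [t] preserves definiteness. *)
Lemma lyapunov_posdef_weak : posdef (S b) ->
  forall t, a <= t <= b -> posdef (S t).
Proof.
move=> Sb t abt; have [d d0 dS'] := posdef_coercive _ Sb; have [Sbs _] := Sb.
pose N : R := n%:R ^+ 2 * `|1%:M : 'M[R]_n|.
have N0 : 0 <= N by rewrite mulr_ge0 ?sqr_ge0.
(* Dividing by the exponential makes the shift at [b] equal to [- d / (N + 1)], and [N * |w|^2]
   bounds the form of the identity at [w]. *)
pose e := d / (N + 1) / expR (1 * k * b).
have e0 : 0 < e by rewrite !divr_gt0 ?expR_gt0// ltr_wpDl.
have : posdef (S t + (- e * expR (1 * k * t)) *: 1%:M).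
  apply: (@lyapunov_exp_shift (- e) 1) => //.
  - by rewrite oppr_eq0 gt_eqF.
  - by rewrite normrN gtr0_norm// mul1r.
  - by rewrite normr1.
  split=> [|w w0]; first by rewrite linearD linearZ/= Sbs tr_scalar_mx.
  rewrite -/(qform w _) qformD qformZ mulNr /e mulfVK ?gt_eqF ?expR_gt0//.
  have w2 : 0 < `|w| ^+ 2 by rewrite exprn_gt0 ?normr_gt0.
  rewrite mulNr subr_gt0 (lt_le_trans _ (dS' w))// mulrAC ltr_pdivrMr ?ltr_wpDl//.
  rewrite -mulrA ltr_pM2l//.
  have := norm_qform_le w 1%:M; rewrite -/N ler_norml => /andP[_ h].
  by rewrite (le_lt_trans h)// mulrC mulrDr mulr1 ltrDl.
move=> [_ St]; split=> [|v /St]; first exact: symS.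
rewrite -!/(qform v _) qformD qformZ mulNr mulNr subr_gt0; apply: le_lt_trans.
by rewrite mulr_ge0 ?qform1_ge0// mulr_ge0 ?expR_ge0 ?(ltW e0).
Qed.

End Weighted.
End Lyapunov.

Lemma possemidef_congr {R : realType} {m n : nat} (B : 'M[R]_(n, m)) (X : 'M[R]_m) :
  possemidef X -> possemidef (B *m X *m B^T).
Proof.
move=> [Xs Xp]; split=> [|v]; first by rewrite !trmx_mul trmxK Xs mulmxA.
by have := Xp (B^T *m v); rewrite trmx_mul trmxK !mulmxA.
Qed.

(** * Bounded functions on a time interval *)

Section BoundedOn.
Context {R : realType} (a b : R).

Definition bounded_on {V : normedModType R} (f : R -> V) :=
  exists c, forall t, a <= t <= b -> `|f t| <= c.

Lemma bounded_onD {V : normedModType R} (f g : R -> V) :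
  bounded_on f -> bounded_on g -> bounded_on (fun t => f t + g t).
Proof.
move=> [c fc] [d gd]; exists (c + d) => t abt.
by rewrite (le_trans (ler_normD _ _))// lerD ?fc ?gd.
Qed.

Lemma bounded_onN {V : normedModType R} (f : R -> V) :
  bounded_on f -> bounded_on (fun t => - f t).
Proof. by move=> [c fc]; exists c => t abt; rewrite normrN fc. Qed.

Lemma bounded_onZ {V : normedModType R} (k : R) (f : R -> V) :
  bounded_on f -> bounded_on (fun t => k *: f t).
Proof.
by move=> [c fc]; exists (`|k| * c) => t abt; rewrite normrZ ler_wpM2l ?fc.
Qed.

Lemma bounded_on_sum {V : normedModType R} {I : finType} (f : I -> R -> V) :
  (forall i, bounded_on (f i)) -> bounded_on (fun t => \sum_i f i t).
Proof.
move=> /choice[c fc]; exists (\sum_i c i) => t abt.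
by rewrite (le_trans (ler_norm_sum _ _ _))// ler_sum// => i _; exact: fc.
Qed.

Lemma bounded_on_mulmx {m n p : nat} (f : R -> 'M[R]_(m, n))
    (g : R -> 'M[R]_(n, p)) :
  bounded_on f -> bounded_on g -> bounded_on (fun t => f t *m g t).
Proof.
move=> [c fc] [d gd]; exists (n%:R * c * d) => t abt.
rewrite (le_trans (mx_norm_mul _ _))// ler_pM ?mulr_ge0 ?gd//.
by rewrite ler_wpM2l ?fc.
Qed.

Lemma within_continuous_bounded_on {V : normedModType R} (f : R -> V) :
  {within `[a, b], continuous f} -> bounded_on f.
Proof.
move=> cf; have /compact_bounded[c [_ fc]] :=
  continuous_compact cf (@segment_compact R a b).
exists (c + 1) => t abt; apply: fc; first by rewrite ltrDl.
by exists t => //=; rewrite in_itv.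
Qed.

Lemma bounded_near_on {V : normedModType R} (a' b' : R) (f : R -> V) :
  a' <= a -> b <= b' -> [bounded f t | t in `[a', b']] -> bounded_on f.
Proof.
move=> aa bb [c [_ fc]]; exists (c + 1) => t /andP[at_ tb].
by apply: fc; rewrite ?ltrDl//= in_itv/= (le_trans aa at_) (le_trans tb bb).
Qed.

End BoundedOn.

(** * The coupled Riccati equations as Lyapunov equations *)

Section Riccati.
Context {R : realType} {n M : nat} (G : lq_game R n M).
Context (a : R) (S : 'I_M -> R -> 'M[R]_n).
Hypothesis hG : all_against_one G.
Hypothesis hS : riccati_solution G a S.
Hypothesis ha : t_init G <= a.
Let b := t_final G.

(** The state matrix under the feedback [u_j = - R_j^-1 B_j^T S_j x]. *)
Definition closed_loop (t : R) : 'M[R]_n :=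
  gA G t - \sum_(j < M) gH G j t *m S j t.

Lemma gH_possemidef i t : a <= t <= b -> possemidef (gH G i t).
Proof.
move=> /andP[at_ tb]; apply/possemidef_congr/possemidef_inv/(aao_R_posdef hG).
by rewrite in_itv/= (le_trans ha at_).
Qed.

Lemma riccati_sym i t : a <= t <= b -> (S i t)^T = S i t.
Proof. by move=> abt; apply: (ric_sym hS); rewrite in_itv. Qed.

Lemma closed_loop_bounded : bounded_on a b closed_loop.
Proof.
apply: bounded_onD.
  exact: bounded_near_on ha (lexx _) (aao_A_bounded hG).
apply/bounded_onN/bounded_on_sum => j; apply: bounded_on_mulmx.
  exact: bounded_near_on ha (lexx _) (aao_H_bounded hG j).
exact/within_continuous_bounded_on/(ric_continuous hS).
Qed.

(** By symmetry of [H_j] and [S_j], the sums of [S_i H_j S_j] and [S_j H_j S_i] are absorbed by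
    [S_i F] and [F^T S_i]. The set [E] joins the points where [S i] may lack a derivative to those
    where the equation may fail. *)
Lemma riccati_closed_loop i : exists E : seq R, forall t,
  a < t < b -> t \notin E ->
  is_derive t (1 : R) (S i) (- (S i t *m closed_loop t
    + (closed_loop t)^T *m S i t + (gQ G i t + S i t *m gH G i t *m S i t))).
Proof.
have [E1 dS] := ric_C1 hS i; have [E2 eqS] := ric_eq hS.
exists (E1 ++ E2) => t abt; rewrite mem_cat negb_or => /andP[tE1 tE2].
have tI : t \in `]a, b[ by rewrite in_itv.
have [dSt _] := dS t tI tE1; have := eqS t tI tE2 i; rewrite /riccati_at.
have abt' : a <= t <= b by case/andP: abt => /ltW-> /ltW->.
rewrite derive1E => eqt; have := derivableP dSt; congr is_derive.
apply/eqP; rewrite -addr_eq0 -eqt; apply/eqP.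
have -> : S i t *m closed_loop t = S i t *m gA G t
    - \sum_(j < M) S i t *m gH G j t *m S j t.
  rewrite mulmxBr mulmx_sumr; congr (_ - _).
  by apply: eq_bigr => j _; rewrite mulmxA.
have -> : (closed_loop t)^T *m S i t = (gA G t)^T *m S i t
    - \sum_(j < M) S j t *m gH G j t *m S i t.
  rewrite linearB linear_sum mulmxBl mulmx_suml; congr (_ - _).
  apply: eq_bigr => j _; have [Hs _] := gH_possemidef j t abt'.
  by rewrite /= trmx_mul Hs riccati_sym.
rewrite big_split/= opprD; apply/matrixP => x y; rewrite !mxE; ring.
Qed.

Lemma qform_riccati_ge0 i t v : a <= t <= b ->
  0 <= qform v (S i t *m gH G i t *m S i t).
Proof.
move=> abt; rewrite -[X in _ *m X](riccati_sym i t abt).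
by have [_] := possemidef_congr (S i t) _ (gH_possemidef i t abt); exact.
Qed.

Lemma riccati_possemidef (i : 'I_M) : i <> 0%N :> nat ->
  forall t, a <= t <= b -> possemidef (S i t).
Proof.
move=> i0; have [E dS] := riccati_closed_loop i.
have [f Ff] := closed_loop_bounded.
apply: (lyapunov_possemidef (S i) closed_loop
  (fun t => gQ G i t + S i t *m gH G i t *m S i t) E a b f
  (@ric_continuous _ _ _ _ _ _ hS i) (riccati_sym i) Ff dS).
- move=> t abt v; rewrite qformD addr_ge0 ?qform_riccati_ge0//.
  have [_] : possemidef (gQ G i t); last exact.
  apply: (aao_Q_others hG i0).
  by rewrite in_itv/=; case/andP: abt => at_ ->; rewrite (le_trans ha at_).
- by rewrite (ric_final hS); exact: (aao_Sf_others hG).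
Qed.

(** [- gQ G i t] is definite at each time, but without a coercivity constant common to all times;
    hence the appeal to [lyapunov_posdef_weak]. *)
Lemma riccati_negdef (i : 'I_M) : i = 0%N :> nat ->
  forall t, a <= t <= b -> negdef (S i t).
Proof.
move=> i0 t abt; apply/posdefN; move: t abt.
have [E dS] := riccati_closed_loop i.
(* The factor one half occurs because [S F] and [F^T S] each produce one copy of [S_i H_i S_i]. *)
pose F t := closed_loop t + 2^-1 *: (gH G i t *m S i t).
have [f Ff] : bounded_on a b F.
  apply: (bounded_onD _ _ _ _ closed_loop_bounded).
  apply/bounded_onZ/bounded_on_mulmx.
    exact: bounded_near_on ha (lexx _) (aao_H_bounded hG i).
  exact/within_continuous_bounded_on/(ric_continuous hS).
apply: (lyapunov_posdef_weak (fun t => - S i t) F (fun t => - gQ G i t) E a b f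
  _ _ Ff).
- by move=> s; apply: cvgN; exact: (@ric_continuous _ _ _ _ _ _ hS i s).
- by move=> t abt; rewrite linearN/= riccati_sym.
- move=> t abt tE; have := is_deriveN (dS t abt tE); congr is_derive.
  have abt' : a <= t <= b by case/andP: abt => /ltW-> /ltW->.
  have [Hs _] := gH_possemidef i t abt'.
  have FT : (F t)^T = (closed_loop t)^T + 2^-1 *: (S i t *m gH G i t).
    by rewrite linearD linearZ/= trmx_mul Hs riccati_sym.
  have -> : - S i t *m F t = - (S i t *m closed_loop t
      + 2^-1 *: (S i t *m gH G i t *m S i t)).
    by rewrite mulNmx mulmxDr -scalemxAr mulmxA.
  have -> : (F t)^T *m - S i t = - ((closed_loop t)^T *m S i t
      + 2^-1 *: (S i t *m gH G i t *m S i t)).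
    by rewrite FT mulmxN mulmxDl -scalemxAl.
  apply/matrixP => x y; rewrite !mxE; by field.
- move=> t abt v; rewrite qformN oppr_ge0.
  have Qn : possemidef (- gQ G i t).
    apply/possemidefW/posdefN; apply: (aao_Q_lone hG i0).
    by rewrite in_itv/=; case/andP: abt => at_ ->; rewrite (le_trans ha at_).
  by have [_ /(_ v)] := Qn; rewrite -/(qform _ _) qformN oppr_ge0.
- by apply/posdefN; rewrite (ric_final hS); exact: (aao_Sf_lone hG).
Qed.

End Riccati.

Theorem theorem1 (R : realType) (n M : nat) (G : lq_game R n M)
    (hG : all_against_one G) (delta : R)
    (hdelta : 0 < delta <= t_final G - t_init G)
    (S : 'I_M -> R -> 'M[R]_n)
    (hS : riccati_solution G (t_final G - delta) S) :
  forall t : R, t \in `[t_final G - delta, t_final G] ->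
    (forall i : 'I_M, i = 0%N :> nat -> negdef (S i t)) /\
    (forall i : 'I_M, i <> 0%N :> nat -> possemidef (S i t)).
Proof.
have ha : t_init G <= t_final G - delta.
  by case/andP: hdelta => _; rewrite lerBrDl lerBrDr addrC.
move=> t; rewrite in_itv/= => abt; split=> i i0.
- exact: riccati_negdef hG hS ha i i0 t abt.
- exact: riccati_possemidef hG hS ha i i0 t abt.
Qed.
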